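(* Let $\zeta\in\mathbb{C}^n$ and let $S_1,S_2$ be two algebraically restricted systems of differential equations with $\mathfrak{Sol}_\zeta(S_1)\subseteq\mathfrak{Sol}_\zeta(S_2)$. (1) Assume that both counting sequences $c(S_1)$ and $c(S_2)$ exist and that $c(S_1)(\ell),c(S_2)(\ell)\in\mathbb{Z}[\infty]$ for all $\ell\in\mathbb{Z}_{\ge0}$. Then $\mathfrak{Sol}_\zeta(S_1)=\mathfrak{Sol}_\zeta(S_2)$ if and only if $c(S_1)(\ell)=c(S_2)(\ell)$ for all $\ell\in\mathbb{Z}_{\ge0}$. In particular, $c(S_1)$ is the unique counting sequence of $S_1$. (2) Assume that both differential counting polynomials $\bar c(S_1)$ and $\bar c(S_2)$ exist and that $\bar c(S_1),\bar c(S_2)\in\mathbb{Q}[\ell,\infty,\infty^\ell,\infty^{\frac{\ell^2}{2!}},\ldots,\infty^{\frac{\ell^n}{n!}}]$. Then $\mathfrak{Sol}_\zeta(S_1)=\mathfrak{Sol}_\zeta(S_2)$ if and only if $\bar c(S_1)=\bar c(S_2)$. In particular, $\bar c(S_1)$ is the unique differential counting polynomial of $S_1$.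
   Context: **Algebraic counting polynomials.** Let $\pi_i:\mathbb{C}^N\to\mathbb{C}^i$, $(a_1,\ldots,a_N)\mapsto(a_1,\ldots,a_i)$. Let $\infty,\aleph_0$ be free indeterminates. For $V\subseteq\mathbb{C}^N$, any element $c(V)\in\mathbb{Z}[\infty,\aleph_0]$ constructed by iteratively (finitely often) applying the following five axioms is called an algebraic counting polynomial of $V$ (it need not exist or be unique): (1) $c(V)=|V|$ if $V$ is finite; (2) $c(V)=\infty$ if $V$ is an affine $1$-space over $\mathbb{C}$; (3) $c(V\uplus W)=c(V)+c(W)$ for disjoint $V,W$; (4) if for some $i$ each non-empty fiber $W$ of $\pi_i|_V$ has the same value under $c$, then $c(V)=c(W)\cdot c(\pi_i(V))$ (fibers are viewed as subsets of $\mathbb{C}^{N-i}$); (5) $c(\mathbb{C}^1\setminus M)=\infty-\aleph_0$ for countably infinite $M\subset\mathbb{C}^1$. **Differential setting.** $F\supseteq\mathbb{C}$ is a field of meromorphic functions in $n$ complex variables $x_1,\ldots,x_n$, $\Delta=\{\partial_{x_1},\ldots,\partial_{x_n}\}$, $U=\{u^{(1)},\ldots,u^{(m)}\}$ is a set of differential indeterminates, $u^{(j)}_\mu=\partial^\mu u^{(j)}$ for $\mu\in\mathbb{Z}_{\ge0}^n$, and $F\{U\}$ is the differential polynomial ring, i.e. the polynomial ring over $F$ in all $u^{(j)}_\mu$. An orderly ranking $<$ is fixed: a total order of the $u^{(j)}_\mu$ with $u^{(j)}_\mu<\partial u^{(j)}_\mu$, with $u^{(j)}_\mu<u^{(j')}_{\mu'}\Rightarrow\partial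 u^{(j)}_\mu<\partial u^{(j')}_{\mu'}$ for $\partial\in\Delta$, and with $|\mu|<|\mu'|\Rightarrow u^{(j)}_\mu<u^{(j')}_{\mu'}$, where $|\mu|=\mu_1+\ldots+\mu_n$. Let $G=\{g^{(j)}_\mu\mid\mu\in\mathbb{Z}_{\ge0}^n,1\le j\le m\}$ be indeterminates, ordered via $u^{(j)}_\mu\leftrightarrow g^{(j)}_\mu$; $\mathbb{C}[G]$ is the polynomial ring of power series coefficients and $\mathbb{C}[G]_{\le\ell}$ the subring generated by the $g^{(j)}_\mu$ with $|\mu|\le\ell$. An algebraically restricted system of differential equations is a finite union of differential equations $p=0$ with $p\in F\{U\}$, equations in $\mathbb{C}[G]$, and inequations ($\ne0$) in $\mathbb{C}[G]$. For $\zeta\in\mathbb{C}^n$ at which the coefficients of the differential equations are holomorphic, let $P_\zeta=\mathbb{C}[[x_1-\zeta_1,\ldots,x_n-\zeta_n]]$. $\mathfrak{Sol}_\zeta(S)\subseteq P_\zeta^U$ is the set of tuples $f$ of formal power series solving all differential equations of $S$ (in the usual sense) and such that each equation (inequation) of $S$ in $\mathbb{C}[G]$ evaluates to zero (non-zero) when $g^{(j)}_\mu$ is replaced by the coefficient of $(x_1-\zeta_1)^{\mu_1}\cdots(x_n-\zeta_n)^{\mu_n}$ in $f(u^{(j)})$. $\mathfrak{Sol}_\zeta(S)_{\le\ell}$ is the image of $\mathfrak{Sol}_\zeta(S)$ in $P_\zeta^U/P_{\zeta,>\ell}^U$, where $P_{\zeta,>\ell}^U$ is the submodule generated by the monomials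 of total degree $>\ell$ in each component; the quotient is identified with the affine space with coordinates $g^{(j)}_\mu$, $|\mu|\le\ell$, ordered by the ranking. **Differential counting.** An $\ell$-th differential counting polynomial of $S$ is an algebraic counting polynomial in $\mathbb{Z}[\infty,\aleph_0]$ of $\mathfrak{Sol}_\zeta(S)_{\le\ell}$ (written as a countable disjoint union of solution sets of algebraic systems of finitely many equations and countably many inequations in $\mathbb{C}[G]_{\le\ell}$), if one exists. If an $\ell$-th differential counting polynomial $c(S)(\ell)$ exists for all $\ell\in\mathbb{Z}_{\ge0}$, the sequence $c(S):\ell\mapsto c(S)(\ell)$ is a counting sequence of $S$. If there is $p\in\mathbb{Q}[\ell,\aleph_0,\infty,\infty^\ell,\infty^{\frac{\ell^2}{2!}},\ldots,\infty^{\frac{\ell^n}{n!}}]$ such that $c(S)(\ell)=p$ (evaluated at $\ell$) for all sufficiently large $\ell$, then $p$ is a differential counting polynomial of $S$, denoted $\bar c(S)$. Powers of $\infty$ are combined in the usual way, e.g. $\infty^{\ell^2}$ stands for $(\infty^{\frac{\ell^2}{2!}})^2$. *)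

(* Defs.v *)
From HB Require Import structures.
From mathcomp Require Import all_boot all_order all_algebra finmap.
From mathcomp Require Import boolp classical_sets functions cardinality reals.
From mathcomp Require Import complex.
From mathcomp Require Import monalg mpoly.

(* monalg also declares this notation, for polynomials in its own sense *)
Notation "{ 'mpoly' T [ n ] }" := (mpoly.mpoly n T) : type_scope.

Set Implicit Arguments.
Unset Strict Implicit.
Unset Printing Implicit Defensive.

Import Order.TTheory GRing.Theory Num.Theory.

Local Open Scope ring_scope.
Local Open Scope classical_set_scope.

(* -------------------------------------------------------------------------- *)
(* Formal power series in n variables: the series with coefficients f k       *)
(* (k a multi-index) is the function f itself, with the Cauchy product.       *)

Definition mps (n : nat) (A : Type) : Type := 'X_{1..n} -> A.

Section PowerSeriesRing.
Variables (n : nat) (A : comNzRingType).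
Implicit Types (f g h : mps n A) (k : 'X_{1..n}).

HB.instance Definition _ := GRing.Zmodule.copy (mps n A) ('X_{1..n} -> A).

Definition mps_one : mps n A := fun k => (k == 0%MM)%:R.

Definition mps_mul f g : mps n A := fun k =>
  \sum_(h : 'X_{1..n < (mdeg k).+1} | (bmnm h <= k)%MM) f h * g (k - h)%MM.

Definition mps_trunc (b : nat) f : {mpoly A[n]} :=
  \sum_(h : 'X_{1..n < b}) f h *: 'X_[h].

Lemma mps_truncE b f k : (mdeg k < b)%N -> (mps_trunc b f)@_k = f k.
Proof. exact: mcoeff_mpoly. Qed.

Lemma mps_mulE (b : nat) f g (p q : {mpoly A[n]}) k : (mdeg k < b)%N ->
  (forall l, (mdeg l < b)%N -> p@_l = f l) ->
  (forall l, (mdeg l < b)%N -> q@_l = g l) ->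
  mps_mul f g k = (p * q)@_k.
Proof.
move=> kb pf qg.
have -> : (p * q)@_k = \sum_(h : 'X_{1..n < (mdeg k).+1} | (bmnm h <= k)%MM)
    p@_h * q@_(k - h) := mcoeff_poly_mul_lin _ _ (ltnSn (mdeg k)).
apply: eq_bigr => h hk.
rewrite pf ?qg //.
- exact: leq_ltn_trans (mdegB _ _) kb.
- exact: leq_trans (bmdeg h) kb.
Qed.

Lemma mps_trunc_mul b f g k : (mdeg k < b)%N ->
  mps_mul f g k = (mps_trunc b f * mps_trunc b g)@_k.
Proof. by move=> kb; apply: mps_mulE kb _ _ => h; exact: mps_truncE. Qed.

Fact mps_mulA : associative mps_mul.
Proof.
move=> f g h; apply/funext => k; set b := (mdeg k).+1.
rewrite (@mps_mulE b _ _ (mps_trunc b f) (mps_trunc b g * mps_trunc b h)) //;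
  first last.
- by move=> l lb; rewrite (mps_trunc_mul _ _ lb).
- exact: mps_truncE.
rewrite mulrA; symmetry; apply: (@mps_mulE b) => //.
- by move=> l lb; rewrite (mps_trunc_mul _ _ lb).
- exact: mps_truncE.
Qed.

Fact mps_mulC : commutative mps_mul.
Proof.
move=> f g; apply/funext => k.
by rewrite !(@mps_trunc_mul (mdeg k).+1) // mulrC.
Qed.

Fact mps_mul1 : left_id mps_one mps_mul.
Proof.
move=> f; apply/funext => k; set b := (mdeg k).+1.
rewrite (@mps_mulE b _ _ 1 (mps_trunc b f)) //.
- by rewrite mul1r mps_truncE.
- by move=> h _; rewrite mcoeff1.
- exact: mps_truncE.
Qed.

Fact mps_mulDl : left_distributive mps_mul +%R.
Proof.
move=> f g h; apply/funext => k.
change (mps_mul (f + g) h k = mps_mul f h k + mps_mul g h k).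
rewrite /mps_mul -big_split /=.
by apply: eq_bigr => l _; rewrite mulrDl.
Qed.

Fact mps_one_neq0 : mps_one != 0.
Proof.
apply/eqP => /(congr1 (fun f => f 0%MM)).
by rewrite /mps_one eqxx => /eqP; rewrite oner_eq0.
Qed.

HB.instance Definition _ := GRing.Zmodule_isComNzRing.Build (mps n A)
  mps_mulA mps_mulC mps_mul1 mps_mulDl mps_one_neq0.

(* d^mu maps x^(k+mu) to ((k+mu)!/k!) x^k *)
Definition mps_deriv (mu : 'X_{1..n}) f : mps n A :=
  fun k => f (k + mu)%MM *+ \prod_(i < n) (k i + mu i) ^_ (mu i).

End PowerSeriesRing.

(* -------------------------------------------------------------------------- *)
(* The order of R[i] is partial: 0 < e forces e to be real.                   *)

Section Meromorphic.
Variables (R : realType) (n : nat).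
Local Notation C := R[i].
Local Notation "''C^n'" := ('rV[C]_n).

Definition polydisc (a : 'C^n) (r : C) : set 'C^n :=
  [set z | forall i, `|z 0 i - a 0 i| < r].

Definition open_set (U : set 'C^n) :=
  forall a, U a -> exists2 r, 0 < r & polydisc a r `<=` U.

Definition is_domain (U : set 'C^n) :=
  [/\ U !=set0, open_set U &
    forall A B, open_set A -> open_set B -> A `|` B = U -> A `&` B = set0 ->
      A = set0 \/ B = set0].

(* (unconditional) convergence of the series c at w, with sum s *)
Definition mps_sums_to (c : mps n C) (w : 'C^n) (s : C) :=
  forall e : C, 0 < e -> exists A : {fset 'X_{1..n}},
    forall B : {fset 'X_{1..n}}, (A `<=` B)%fset ->
      `|\sum_(k <- B) c k * \prod_(i < n) w 0 i ^+ k i - s| < e.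

Definition has_taylor (f : 'C^n -> C) (a : 'C^n) (c : mps n C) :=
  exists2 r, 0 < r & forall z, polydisc a r z -> mps_sums_to c (z - a) (f z).

Definition holomorphic_on (U : set 'C^n) (f : 'C^n -> C) :=
  forall a, U a -> exists c, has_taylor f a c.

(* f restricted to D is a meromorphic function on U whose set of points of    *)
(* holomorphy is D; the values of f outside D are junk.                       *)
Definition meromorphic_on (U D : set 'C^n) (f : 'C^n -> C) :=
  [/\ D `<=` U, open_set D, holomorphic_on D f,
      forall a, U a -> exists r g h,
        [/\ 0 < r, holomorphic_on (polydisc a r) g,
            holomorphic_on (polydisc a r) h,
            exists2 z, polydisc a r z & h z != 0 &
            forall z, polydisc a r z -> h z != 0 -> D z /\ f z = g z / h z]
    & forall a g r, U a -> 0 < r -> holomorphic_on (polydisc a r) g ->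
        (forall z, polydisc a r z -> D z -> f z = g z) -> D a].

(* A field containing the constants and consisting of meromorphic functions   *)
(* on a domain; field_hol f is the set of points at which f is holomorphic.   *)
Record meromorphic_field := MeromorphicField {
  field_sort :> fieldType;
  field_dom : set 'C^n;
  field_hol : field_sort -> set 'C^n;
  field_val : field_sort -> 'C^n -> C;
  field_dom_domain : is_domain field_dom;
  field_meromorphic : forall f,
    meromorphic_on field_dom (field_hol f) (field_val f);
  field_valD : forall f g z, field_hol f z -> field_hol g z ->
    field_hol (f + g) z /\ field_val (f + g) z = field_val f z + field_val g z;
  field_valM : forall f g z, field_hol f z -> field_hol g z ->
    field_hol (f * g) z /\ field_val (f * g) z = field_val f z * field_val g z;
  field_val1 : forall z, field_dom z ->
    field_hol 1 z /\ field_val 1 z = 1;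
  field_const : forall c : C, exists f, forall z, field_dom z ->
    field_hol f z /\ field_val f z = c
}.

(* The Taylor series at zeta of a function holomorphic at zeta (it is unique) *)
Definition taylor (F : meromorphic_field) (zeta : 'C^n) (f : F) : mps n C :=
  xget 0 [set c | has_taylor (field_val f) zeta c].

End Meromorphic.

(* -------------------------------------------------------------------------- *)
(* The pair (j, mu) indexes both the jet variable u^(j)_mu and the power      *)
(* series coefficient g^(j)_mu.                                               *)

Definition jet (m n : nat) : Type := ('I_m * 'X_{1..n})%type.
HB.instance Definition _ m n := Choice.on (jet m n).

Definition orderly_ranking (m n : nat) (lt : rel (jet m n)) :=
  [/\ [/\ irreflexive lt, transitive lt & forall x y, x != y -> lt x y || lt y x],
      forall j mu i, lt (j, mu) (j, mu + U_(i))%MM,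
      forall j mu j' mu' i, lt (j, mu) (j', mu') ->
        lt (j, mu + U_(i))%MM (j', mu' + U_(i))%MM
    & forall j mu j' mu', (mdeg mu < mdeg mu')%N -> lt (j, mu) (j', mu')].

(* The polynomial ring over A in all u^(j)_mu (resp. all g^(j)_mu)            *)
Notation jet_poly m n A := {malg A[{cmonom (jet m n)}]}.

(* Evaluation of a polynomial: sigma on coefficients, v on variables          *)
Definition jet_eval (m n : nat) (A : zmodType) (B : comNzRingType)
    (sigma : A -> B) (v : jet m n -> B) (p : jet_poly m n A) : B :=
  monalg.mmap sigma (fun k : {cmonom (jet m n)} =>
    \prod_(x <- finsupp k) v x ^+ k x) p.

Record ar_system (R : realType) (m n : nat) (F : meromorphic_field R n) :=
  ARSystem {
    diff_eqs : seq (jet_poly m n F);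
    coef_eqs : seq (jet_poly m n R[i]);
    coef_ineqs : seq (jet_poly m n R[i])
  }.

Section Solutions.
Variables (R : realType) (m n : nat) (F : meromorphic_field R n).
Local Notation C := R[i].
Implicit Types (zeta : 'rV[C]_n) (S : ar_system m F).

Definition coefs_holomorphic_at zeta S :=
  forall p, p \in diff_eqs S ->
  forall k, k \in monalg.msupp p -> field_hol (monalg.mcoeff k p) zeta.

(* Elements of P_zeta^U are families f of power series in x - zeta. *)
Definition Sol zeta S : set ('I_m -> mps n C) :=
  [set f | [/\ forall p, p \in diff_eqs S ->
                 jet_eval (taylor zeta) (fun x => mps_deriv x.2 (f x.1)) p = 0,
               forall p, p \in coef_eqs S ->
                 jet_eval idfun (fun x => f x.1 x.2) p = 0
             & forall p, p \in coef_ineqs S ->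
                 jet_eval idfun (fun x => f x.1 x.2) p != 0]].

Variable lt : rel (jet m n).

Definition jets_upto (l : nat) : seq (jet m n) :=
  sort (fun x y => (x == y) || lt x y)
    [seq ((x.1, bmnm x.2) : jet m n) | x <- enum {: 'I_m * 'X_{1..n < l.+1}}].

Definition truncate (l : nat) (f : 'I_m -> mps n C) :
    'rV[C]_(size (jets_upto l)) :=
  \row_i (let x := tnth (in_tuple (jets_upto l)) i in f x.1 x.2).

Definition Sol_upto zeta S (l : nat) : set 'rV[C]_(size (jets_upto l)) :=
  @truncate l @` Sol zeta S.

End Solutions.

Arguments truncate {R m n} lt l f.
Arguments Sol_upto {R m n F} lt zeta S l _.

Notation count_poly := {mpoly int[2]}.
Definition infty : count_poly := 'X_ord0.
Definition aleph0 : count_poly := 'X_ord_max.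

Definition free_of (k : nat) (A : nzRingType) (v : 'I_k) (p : {mpoly A[k]}) :=
  forall M, M \in msupp p -> M v = 0%N.

Definition aleph0_free (p : count_poly) := free_of ord_max p.

(* counted s V p: p is obtained for V by at most s nested applications of the *)
(* axioms. Additivity is also used to solve for a summand, as needed for      *)
(* C minus finitely many points, but only as long as aleph0 does not occur:   *)
(* C \ N and C \ (N \ {0}) both have the value infty - aleph0, so cancelling  *)
(* that value would give the value 0 to the point {0}.                        *)
Inductive counted (R : realType) :
    nat -> forall N : nat, set 'rV[R[i]]_N -> count_poly -> Prop :=
| counted_finite s N (V : set 'rV_N) :
    finite_set V -> counted s V (#|` fset_set V|%fset)%:R
| counted_line s N (a v : 'rV_N) :
    v != 0 -> counted s [set a + t *: v | t in [set: R[i]]] infty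
| counted_union s N (V W : set 'rV_N) p q :
    V `&` W = set0 -> counted s V p -> counted s W q ->
    counted s.+1 (V `|` W) (p + q)
| counted_summand s N (V W : set 'rV_N) p q :
    V `&` W = set0 -> counted s (V `|` W) p -> counted s W q ->
    aleph0_free p -> aleph0_free q ->
    counted s.+1 V (p - q)
| counted_fibration s i d (V : set 'rV_(i + d)) p q :
    (forall a, (lsubmx @` V) a -> counted s [set b | V (row_mx a b)] p) ->
    counted s (lsubmx @` V) q ->
    counted s.+1 V (p * q)
| counted_cocountable s (M : set 'rV_1) :
    countable M -> infinite_set M -> counted s (~` M) (infty - aleph0).

Definition counting_polynomial (R : realType) (N : nat) (V : set 'rV[R[i]]_N)
  (p : count_poly) := exists s, counted s V p.

(* -------------------------------------------------------------------------- *)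
(* The variables of diff_count_poly n are, in this order, l, aleph0, and       *)
(* infty^(l^i/i!) for i = 0..n, the case i = 0 being infty itself.             *)

Notation diff_count_poly n := {mpoly rat[2 + n.+1]}.

Definition diff_aleph0 (n : nat) : 'I_(2 + n.+1) := lshift n.+1 (ord_max : 'I_2).

Definition diff_aleph0_free (n : nat) (p : diff_count_poly n) :=
  free_of (diff_aleph0 n) p.

(* Evaluating at l may produce the exponents l^i/i! in (1/n!)Z. Both the      *)
(* value of p at l and an element of Z[infty, aleph0] are therefore read in   *)
(* Q[y, aleph0] with infty = y^(n!); the latter reading is injective.         *)
Definition diff_count_eval (n l : nat) (p : diff_count_poly n) :
    {mpoly rat[2]} :=
  mmap (fun c : rat => c%:MP) (fun v => match fintype.split v with
    | inl o => if o == ord0 then (l%:R)%:MP else 'X_ord_max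
    | inr i => 'X_ord0 ^+ (n`! %/ i`! * l ^ i)
    end) p.

Definition count_root (n : nat) (p : count_poly) : {mpoly rat[2]} :=
  mmap (fun c : int => c%:~R) (fun v : 'I_2 =>
    if v == ord0 then 'X_ord0 ^+ n`! else 'X_ord_max) p.

Section DifferentialCounting.
Variables (R : realType) (m n : nat) (F : meromorphic_field R n).
Variables (lt : rel (jet m n)) (zeta : 'rV[R[i]]_n) (S : ar_system m F).

Definition counting_sequence (c : nat -> count_poly) :=
  forall l, counting_polynomial (Sol_upto lt zeta S l) (c l).

Definition diff_counting_polynomial (p : diff_count_poly n) :=
  exists2 c, counting_sequence c &
    exists l0, forall l, (l0 <= l)%N -> count_root n (c l) = diff_count_eval l p.

End DifferentialCounting.

(* Main.v *)
(* Call a function on C generically constant if it is constant off a finite set.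
   Integrating generically constant functions one coordinate at a time, with C
   of measure X and finite sets measured by their cardinality, defines a
   finitely additive, Z[X]-valued partial measure on subsets of C^N.  It is
   compatible with axioms (1) to (4), its values have a nonnegative leading
   coefficient, and only the empty set has measure 0.  Hence V <= W of the same
   measure are equal, and it remains to relate this measure to the counting
   polynomials, whose derivations may involve aleph0.  By induction on the
   derivation, a counting polynomial is a polynomial in z = infty - aleph0 whose
   coefficients in Z[infty] have nonnegative leading coefficients, so that
   aleph0 never cancels; and the counted set has a measure exactly when the
   polynomial is free of aleph0, the measure being then the polynomial itself.
   For the systems, a family of power series is a solution as soon as
   arbitrarily long truncations of it are truncations of solutions.  Finally, a
   differential counting polynomial is determined by its values at large l,
   because distinct exponents of infty are distinct polynomials in l. *)

From HB Require Import structures.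
From mathcomp Require Import all_boot all_order all_algebra finmap.
From mathcomp Require Import boolp classical_sets cardinality.
From mathcomp Require Import interval reals complex monalg mpoly.
From mathcomp Require lebesgue_measure.
Require Import Defs.

Set Implicit Arguments.
Unset Strict Implicit.
Unset Printing Implicit Defensive.

Import Order.TTheory GRing.Theory Num.Theory.

Local Open Scope ring_scope.
Local Open Scope classical_set_scope.

(** * Uncountability of the complex numbers *)

(** Countable sets are Lebesgue null, whereas the open unit interval has measure 1. *)
Lemma realType_uncountable (R : realType) : ~ countable [set: R].
Proof.
move=> c.
have := lebesgue_measure.lebesgue_measure_itv (`]0, 1[%R : interval R).
rewrite lebesgue_measure.countable_lebesgue_measure0; last first.
  exact: sub_countable (subset_card_le (@subsetT _ _)) c.
rewrite /= constructive_ereal.lte_fin ltr01.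
by case=> /eqP; rewrite subr0 eq_sym oner_eq0.
Qed.

Lemma complex_uncountable (R : realType) : ~ countable [set: R[i]].
Proof.
move=> c; apply: (@realType_uncountable R).
apply: sub_countable c; rewrite (_ : [set: R] = (@complex.Re R) @` [set: R[i]]).
  exact: card_image_le.
by apply/seteqP; split=> // x _; exists x%:C%C.
Qed.

Lemma countable_setU (T : Type) (A B : set T) :
  countable A -> countable B -> countable (A `|` B).
Proof.
move=> cA cB; rewrite -bigcup2E; apply: bigcup_countable => // i _.
by case: i => [|[|i]] //=; exact: countable0.
Qed.

(** * Integer polynomials with nonnegative leading coefficient *)

Definition nneg (p : {poly int}) := 0 <= lead_coef p.

(** Positive leading coefficients cannot cancel: for different sizes the longer polynomial keeps its
    own, for equal sizes they add. *)
Lemma nnegD_eq0 p q : nneg p -> nneg q ->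
  nneg (p + q) /\ (p + q = 0 -> p = 0 /\ q = 0).
Proof.
rewrite /nneg; have [->|p0] := eqVneq p 0; first by rewrite add0r.
have [->|q0] := eqVneq q 0; first by rewrite addr0.
rewrite le0r lead_coef_eq0 (negPf p0) le0r lead_coef_eq0 (negPf q0) /= => pp qp.
suff s : 0 < lead_coef (p + q).
  by split; [exact: ltW|move=> e; rewrite e lead_coef0 ltxx in s].
have [pq|pq|pq] := ltngtP (size p) (size q).
- by rewrite addrC lead_coefDl.
- by rewrite lead_coefDl.
have c : 0 < (p + q)`_(size p).-1 by rewrite coefD {2}pq addr_gt0.
have e : size (p + q) = size p.
  apply/anti_leq; rewrite (leq_trans (size_polyD _ _)) ?pq ?maxnn //=.
  rewrite -pq -[leqLHS]prednK ?size_poly_gt0 // ltnNge.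
  by apply/negP => /leq_sizeP/(_ _ (leqnn _)) e; rewrite e ltxx in c.
by rewrite /lead_coef e.
Qed.

Lemma nnegD p q : nneg p -> nneg q -> nneg (p + q).
Proof. by move=> p0 q0; case: (nnegD_eq0 p0 q0). Qed.

Lemma nneg0 : nneg 0.
Proof. by rewrite /nneg lead_coef0. Qed.

Lemma nneg_nat k : nneg k%:R.
Proof. by rewrite /nneg -polyC_natr lead_coefC ler0n. Qed.

Lemma nnegM p q : nneg p -> nneg q -> nneg (p * q).
Proof. by rewrite /nneg lead_coefM; exact: mulr_ge0. Qed.

Lemma nneg_sum_eq0 (I : eqType) (r : seq I) (f : I -> {poly int}) :
  (forall i, i \in r -> nneg (f i)) ->
  nneg (\sum_(i <- r) f i) /\
  (\sum_(i <- r) f i = 0 -> forall i, i \in r -> f i = 0).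
Proof.
elim: r => [|j r IH] f0; first by rewrite big_nil; split => //; exact: nneg0.
have [i ir|sr r0] := IH; first by apply: f0; rewrite in_cons ir orbT.
have [s s0] := nnegD_eq0 (f0 j (mem_head _ _)) sr.
rewrite big_cons; split => // /s0[fj /r0 fr] i.
by rewrite in_cons => /predU1P[->//|/fr].
Qed.

(** * A finitely additive measure on subsets of affine space *)

Section Measure.
Variable K : fieldType.
Hypothesis Kunc : ~ countable [set: K].
Implicit Types (A B D : set (seq K)) (m k g h : {poly int}) (N : nat).

Definition fib A a : set (seq K) := [set s | A (a :: s)].

(* A subset of K^N is given by the sequences of length N in A.  The measure,
   when it exists, is the iterated integral with respect to the measure on K
   for which finite sets have their cardinality as measure and K has measure
   'X; only functions that are constant off a finite set are integrated. *)
Fixpoint tame N A m : Prop :=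
  if N is N'.+1 then
    exists (f : K -> {poly int}) g (S : {fset K}),
      [/\ forall a, tame N' (fib A a) (f a), forall a, a \notin S -> f a = g
        & m = g * 'X + \sum_(a <- S) (f a - g)]
  else m = (`[< A [::] >])%:R.

Lemma fresh (S : {fset K}) : exists a, a \notin S.
Proof.
apply: contrapT => /forallNP nS; apply: Kunc; apply: finite_set_countable.
apply: (sub_finite_set _ (finite_fset S)) => a _ /=.
by have /negP := nS a; rewrite negbK.
Qed.

Lemma widen_sum (f : K -> {poly int}) g (S T : {fset K}) :
  (S `<=` T)%fset -> (forall a, a \notin S -> f a = g) ->
  \sum_(a <- S) (f a - g) = \sum_(a <- T) (f a - g).
Proof.
by move=> ST fg; apply: big_fset_incl => // a _ /fg ->; rewrite subrr.
Qed.

(** Iterated integration is linear in the indicator function; disjoint unions, differences and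
    extensionality are all instances of this. *)
Lemma tame_lin (c d : {poly int}) N A B D m k :
  (forall s, size s = N -> (`[< D s >])%:R =
    c * (`[< A s >])%:R + d * (`[< B s >])%:R) ->
  tame N A m -> tame N B k -> tame N D (c * m + d * k).
Proof.
elim: N A B D m k => [|N IH] A B D m k; first by move=> e /= -> ->; rewrite e.
move=> e /= [f [g [S [ft fg ->]]]] [f' [g' [S' [ft' fg' ->]]]].
exists (fun a => c * f a + d * f' a), (c * g + d * g'), (S `|` S')%fset.
split.
- by move=> a; apply: IH (ft a) (ft' a) => s sN; rewrite e //= sN.
- by move=> a; rewrite in_fsetU negb_or => /andP[/fg -> /fg' ->].
rewrite (widen_sum (fsubsetUl S S')) // (widen_sum (fsubsetUr S S') fg').
rewrite !mulrDr !mulr_sumr addrACA -big_split /= mulrDl !mulrA; congr (_ + _).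
by apply: eq_bigr => a _; rewrite !mulrBr opprD addrACA.
Qed.

Lemma tame_ext N A B m : (forall s, size s = N -> A s <-> B s) ->
  tame N A m -> tame N B m.
Proof.
move=> AB tA; rewrite -[m]mul1r -[1 * m]addr0 -(mul0r m).
apply: (tame_lin _ tA tA) => s sN.
by rewrite mul0r addr0 mul1r (asbool_equiv_eq (AB s sN)).
Qed.

Lemma tame_unique N A m k : tame N A m -> tame N A k -> m = k.
Proof.
elim: N A m k => [|N IH] A m k; first by move=> /= -> ->.
move=> [f [g [S [ft fg ->]]]] [f' [g' [S' [ft' fg' ->]]]].
have ff' : f' = f by apply/funext => a; exact: IH (ft' a) (ft a).
rewrite {}ff' in fg' *.
have gg' : g' = g.
  (* A point outside both exceptional sets takes both generic values. *)
  have [a] := fresh (S `|` S')%fset; rewrite in_fsetU negb_or.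
  by case/andP => /fg <- /fg' <-.
rewrite {}gg' in fg' *; rewrite (widen_sum (fsubsetUl S S')) //.
by rewrite (widen_sum (fsubsetUr S S') fg').
Qed.

Lemma tame_pos N A m : tame N A m ->
  nneg m /\ (m = 0 -> forall s, size s = N -> ~ A s).
Proof.
elim: N A m => [|N IH] A m.
  move=> /= ->; split; first exact: nneg_nat.
  by case: asboolP => [_ /eqP|nA _ s /size0nil -> //]; rewrite oner_eq0.
move=> [f [g [S [ft fg ->]]]].
have [a aS] := fresh S.
have gpos : nneg g by have [] := IH _ _ (ft a); rewrite fg.
have [Spos S0] := @nneg_sum_eq0 _ S f (fun a _ => (IH _ _ (ft a)).1).
(* Regrouping the copies of [g] shows the measure as a sum of [nneg] terms, since ['X] minus a
   constant is monic. *)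
have -> : g * 'X + \sum_(a <- S) (f a - g) =
    g * ('X - (#|` S|%fset%:R)%:P) + \sum_(a <- S) f a.
  rewrite sumrB mulrBr -addrA; congr (_ + _); rewrite addrC; congr (_ + _).
  by rewrite big_const_seq count_predT iter_addr_0 polyC_natr mulr_natr.
have Xpos : nneg ('X - (#|` S|%fset%:R)%:P) by rewrite /nneg lead_coefXsubC.
have [mpos m0] := nnegD_eq0 (nnegM gpos Xpos) Spos; split => // /m0[].
move/eqP; rewrite mulf_eq0 (negPf (monic_neq0 (monicXsubC _))) orbF => /eqP g0.
move=> /S0 fS [//|b s] [sN]; apply: (IH _ _ (ft b)).2 => //.
by have [/fS|/fg] := boolP (b \in S) => // ->.
Qed.

Lemma tame_empty N A : (forall s, size s = N -> ~ A s) -> tame N A 0.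
Proof.
elim: N A => [|N IH] A A0 /=; first by case: asboolP => // /A0; case.
exists (fun=> 0), 0, fset0; split=> //; last by rewrite mul0r big_nil addr0.
by move=> a; apply: IH => s sN; apply: A0; rewrite /= sN.
Qed.

Lemma tame_setU N A B m k :
  (forall s, size s = N -> ~ (A s /\ B s)) ->
  tame N A m -> tame N B k -> tame N (A `|` B) (m + k).
Proof.
move=> AB tA tB; rewrite -[m]mul1r -[k]mul1r; apply: tame_lin tA tB.
move=> s /AB {}AB; rewrite !mul1r asbool_or.
by do 2![case: asboolP => ?]; rewrite ?addr0 ?add0r //; case: AB.
Qed.

Lemma tame_setU_subr N A B m k :
  (forall s, size s = N -> ~ (A s /\ B s)) ->
  tame N (A `|` B) m -> tame N B k -> tame N A (m - k).
Proof.
move=> AB tA tB; rewrite -[m]mul1r -mulN1r; apply: tame_lin tA tB.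
move=> s /AB {}AB; rewrite mul1r mulN1r asbool_or.
by do 2![case: asboolP => ?]; rewrite ?subr0 ?subrr //; case: AB.
Qed.

Lemma tame_fiber i d A m : tame (i + d) A m ->
  forall s, size s = i -> exists k, tame d [set t | A (s ++ t)] k.
Proof.
elim: i A m => [|i IH] A m tA [|a s] //=; first by exists m.
by move=> [si]; have [f [_ [_ [ft _ _]]]] := tA; exact: IH (ft a) s si.
Qed.

Lemma tame_fibration i d A B p q :
  (forall s, size s = i -> B s -> tame d [set t | A (s ++ t)] p) ->
  (forall s t, size s = i -> size t = d -> A (s ++ t) -> B s) ->
  tame i B q -> tame (i + d) A (p * q).
Proof.
elim: i A B q => [|i IH] A B q tA AB.
  move=> /= ->; case: asboolP => [B0|nB]; first by rewrite mulr1;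
    exact: (tA [::] erefl B0).
  by rewrite mulr0; apply: tame_empty => t td /(AB [::] t erefl td).
move=> [f [g [S [ft fg ->]]]]; exists (fun a => p * f a), (p * g), S; split.
- move=> a; apply: (IH _ (fib B a)) (ft a).
    by move=> s si; apply: (tA (a :: s)); rewrite /= si.
  by move=> s t si; apply: (AB (a :: s)); rewrite /= si.
- by move=> a /fg ->.
rewrite mulrDr mulrA mulr_sumr; congr (_ + _).
by apply: eq_bigr => a _; rewrite mulrBr.
Qed.

(** Converse of the product formula: each fiber of [A] has [p] times the measure of the fiber of
    [B], so cancelling the nonzero [p] makes the latter generically constant too. *)
Lemma tame_base i d A B m p : p != 0 ->
  (forall s, size s = i -> B s -> tame d [set t | A (s ++ t)] p) ->
  (forall s t, size s = i -> size t = d -> A (s ++ t) -> B s) ->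
  tame (i + d) A m -> exists q, tame i B q.
Proof.
move=> p0; elim: i A B m => [|i IH] A B m tA AB; first by move=> _; eexists.
move=> [f [g [S [ft fg _]]]].
have tAa a s : size s = i -> fib B a s -> tame d [set t | fib A a (s ++ t)] p.
  by move=> si; apply: (tA (a :: s)); rewrite /= si.
have ABa a s t : size s = i -> size t = d -> fib A a (s ++ t) -> fib B a s.
  by move=> si; apply: (AB (a :: s)); rewrite /= si.
have /choice[h th] a := IH (fib A a) (fib B a) _ (tAa a) (ABa a) (ft a).
have fh a : f a = p * h a.
  by apply: tame_unique (ft a) _; exact: tame_fibration (tAa a) (ABa a) (th a).
have [b bS] := fresh S; eexists; exists h, (h b), S; split=> // a aS.
by apply: (mulfI p0); rewrite -!fh !fg.
Qed.

(* Invariant of the countable sets M removed by axiom (5): it makes sure that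
   the set of points with an exceptional fiber, when infinite, cannot be
   compensated for in a disjoint union, as all but finitely many exceptional
   fibers are smaller than the generic one. *)
Fixpoint good N A : Prop :=
  if N is N'.+1 then
    (forall a, good N' (fib A a)) /\
    forall f, (forall a, tame N' (fib A a) (f a)) ->
      exists g (S : {fset K}),
        (forall a, a \notin S -> nneg (g - f a)) /\ countable [set a | f a <> g]
  else True.

Lemma tame_good N A m : tame N A m -> good N A.
Proof.
elim: N A m => [//|N IH] A m [f [g [S [ft fg _]]]]; split=> [a|f' ft'].
  exact: IH (ft a).
have -> : f' = f by apply/funext => a; exact: tame_unique (ft' a) (ft a).
exists g, S; split=> [a /fg ->|]; first by rewrite subrr; exact: nneg0.
apply: finite_set_countable; apply: (sub_finite_set _ (finite_fset S)) => a /=.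
by apply: contra_notT => /fg.
Qed.

(** Converse of additivity, and the purpose of [good]: uncountability forces the generic values to
    add up, and then nonnegative defects of sum zero must vanish off a finite set. *)
Lemma good_setU_tame N A B m :
  (forall s, size s = N -> ~ (A s /\ B s)) -> good N A -> good N B ->
  tame N (A `|` B) m -> exists m1 m2, tame N A m1 /\ tame N B m2.
Proof.
elim: N A B m => [|N IH] A B m AB gA gB tAB; first by do 2!eexists.
have [f [g [S [ft fg _]]]] := tAB; have [gAa gA1] := gA; have [gBa gB1] := gB.
have ABa a s : size s = N -> ~ (fib A a s /\ fib B a s).
  by move=> sN; apply: (AB (a :: s)); rewrite /= sN.
have tU a : exists k : {poly int} * {poly int},
    tame N (fib A a) k.1 /\ tame N (fib B a) k.2.
  have [m1 [m2 t12]] := IH _ _ _ (ABa a) (gAa a) (gBa a) (ft a).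
  by exists (m1, m2).
have [h /all_and2[tA tB]] := choice tU.
have fh a : f a = (h a).1 + (h a).2.
  exact: tame_unique (ft a) (tame_setU (ABa a) (tA a) (tB a)).
have [g1 [S1 [le1 c1]]] := gA1 _ tA; have [g2 [S2 [le2 c2]]] := gB1 _ tB.
have g12 : g = g1 + g2.
  (* Otherwise [K] is covered by [S] and two countable exceptional sets. *)
  apply: contrapT => gne; apply: Kunc.
  apply: (@sub_countable _ _ _ ([set` S] `|`
      ([set a | (h a).1 <> g1] `|` [set a | (h a).2 <> g2]))).
    apply: subset_card_le => a _ /=; apply: contrapT => /not_orP[/negP aS].
    by move=> /not_orP[/contrapT e1 /contrapT e2]; apply: gne;
      rewrite -(fg a) // fh e1 e2.
  by apply: countable_setU; [exact: countable_fset|exact: countable_setU].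
(* Here the defects [g1 - (h a).1] and [g2 - (h a).2] are [nneg] with sum 0. *)
have eq12 a : a \notin (S `|` (S1 `|` S2))%fset -> (h a).1 = g1 /\ (h a).2 = g2.
  rewrite !in_fsetU !negb_or => /and3P[/fg + /le1 + /le2].
  rewrite fh g12 => e n1 n2; have [_] := nnegD_eq0 n1 n2.
  rewrite addrACA -opprD e subrr => /(_ erefl)[/eqP + /eqP].
  by rewrite !subr_eq0 => /eqP -> /eqP ->.
do 2!eexists; split.
- exists (fun a => (h a).1), g1, (S `|` (S1 `|` S2))%fset.
  by split=> // a /eq12[].
- exists (fun a => (h a).2), g2, (S `|` (S1 `|` S2))%fset.
  by split=> // a /eq12[].
Qed.

(** Tame fibers of the union split into tame fibers of the two sets, and the defects from the
    generic values add. *)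
Lemma good_setU N A B :
  (forall s, size s = N -> ~ (A s /\ B s)) -> good N A -> good N B ->
  good N (A `|` B).
Proof.
elim: N A B => [//|N IH] A B AB [gAa gA1] [gBa gB1].
have ABa a s : size s = N -> ~ (fib A a s /\ fib B a s).
  by move=> sN; apply: (AB (a :: s)); rewrite /= sN.
split=> [a|f ft]; first exact: IH (ABa a) (gAa a) (gBa a).
have tU a : exists k : {poly int} * {poly int},
    tame N (fib A a) k.1 /\ tame N (fib B a) k.2.
  have [m1 [m2 t12]] := good_setU_tame (ABa a) (gAa a) (gBa a) (ft a).
  by exists (m1, m2).
have [h /all_and2[tA tB]] := choice tU.
have fh a : f a = (h a).1 + (h a).2.
  exact: tame_unique (ft a) (tame_setU (ABa a) (tA a) (tB a)).
have [g1 [S1 [le1 c1]]] := gA1 _ tA; have [g2 [S2 [le2 c2]]] := gB1 _ tB.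
exists (g1 + g2), (S1 `|` S2)%fset; split=> [a|].
  rewrite in_fsetU negb_or fh opprD addrACA => /andP[/le1 n1 /le2 n2].
  exact: nnegD.
apply: (@sub_countable _ _ _ ([set a | (h a).1 <> g1] `|`
  [set a | (h a).2 <> g2])).
  apply: subset_card_le => a /= fa; apply: contrapT => /not_orP[].
  by move=> /contrapT e1 /contrapT e2; apply: fa; rewrite fh e1 e2.
exact: countable_setU.
Qed.

(** In the first case, measures of fibers of [A], hence also their defects, are [p] times those for
    [B]. In the second case a tame fiber of [A] over its first coordinate is empty, as a point of it
    would yield a tame fiber over [B]. *)
Lemma good_fibration i d A B p : nneg p ->
  (forall s, size s = i -> B s -> good d [set t | A (s ++ t)]) ->
  (forall s t, size s = i -> size t = d -> A (s ++ t) -> B s) ->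
  good i B ->
  p != 0 /\ (forall s, size s = i -> B s -> tame d [set t | A (s ++ t)] p) \/
  (forall s k, size s = i -> B s -> ~ tame d [set t | A (s ++ t)] k) ->
  good (i + d) A.
Proof.
move=> pge; elim: i A B => [|i IH] A B gA AB gB uA.
  have [B0|nB] := pselect (B [::]); first exact: gA [::] erefl B0.
  by apply: (@tame_good _ _ 0); apply: tame_empty => t td /(AB [::] t erefl td).
have ABa a s t : size s = i -> size t = d -> fib A a (s ++ t) -> fib B a s.
  by move=> si; apply: (AB (a :: s)); rewrite /= si.
split=> [a|f ft].
  apply: IH (ABa a) (gB.1 a) _ => [s si|]; first by apply: (gA (a :: s));
    rewrite /= si.
  case: uA => [[p0 tA]|ntA]; [left; split=> //|right].
    by move=> s si; apply: (tA (a :: s)); rewrite /= si.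
  by move=> s k si; apply: (ntA (a :: s)); rewrite /= si.
case: uA => [[p0 tA]|ntA].
  have tAa a s : size s = i -> fib B a s -> tame d [set t | fib A a (s ++ t)] p.
    by move=> si; apply: (tA (a :: s)); rewrite /= si.
  have /choice[h th] a := tame_base p0 (tAa a) (ABa a) (ft a).
  have fh a : f a = p * h a.
    exact: tame_unique (ft a) (tame_fibration (tAa a) (ABa a) (th a)).
  have [g [S [le cg]]] := gB.2 _ th.
  exists (p * g), S; split=> [a /le n|]; first by rewrite fh -mulrBr;
    exact: nnegM.
  apply: sub_countable cg; apply: subset_card_le => a /= + e.
  by rewrite fh e.
have f0 a : f a = 0.
  apply: tame_unique (ft a) _; apply: tame_empty => u ui Au.
  have si : size (take i u) = i by rewrite size_takel // ui leq_addr.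
  have [k tk] := tame_fiber (ft a) si.
  apply: (ntA (a :: take i u) k) => //=; first by rewrite si.
  apply: (ABa a _ (drop i u)) => //; first by rewrite size_drop ui addKn.
  by rewrite cat_take_drop.
exists 0, fset0; split=> [a _|]; first by rewrite f0 subr0; exact: nneg0.
by rewrite (_ : [set a | _] = set0) //; apply/seteqP; split=> a //= [].
Qed.

Lemma cocountable_good A (M : set K) : countable M ->
  (forall a, A [:: a] <-> ~ M a) -> good 1 A.
Proof.
(* With generic value 1 every defect is 0 or 1, so even the finite exceptional set can be empty. *)
move=> cM AM; split=> // f ft; exists 1, fset0.
have fE a : f a = (`[< ~ M a >])%:R by rewrite (ft a) (asbool_equiv_eq (AM a)).
split=> [a _|].
  rewrite fE; case: asboolP => _; first by rewrite subrr; exact: nneg0.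
  by rewrite subr0; exact: (nneg_nat 1).
apply: sub_countable cM; apply: subset_card_le => a /=; rewrite fE.
by case: asboolP => // /contrapT.
Qed.

(** By uncountability the generic value would be 1, and [M] would lie in the finite exceptional
    set. *)
Lemma cocountable_not_tame A (M : set K) m : countable M -> infinite_set M ->
  (forall a, A [:: a] <-> ~ M a) -> ~ tame 1 A m.
Proof.
move=> cM iM AM [f [g [S [ft fg _]]]].
have fE a : f a = (`[< ~ M a >])%:R by rewrite (ft a) (asbool_equiv_eq (AM a)).
have g1 : g = 1.
  apply: contrapT => gne; apply: Kunc.
  apply: (@sub_countable _ _ _ ([set` S] `|` M)).
    apply: subset_card_le => a _ /=; apply: contrapT => /not_orP[/negP aS Ma].
    by apply: gne; rewrite -(fg a) // fE asboolT.
  by apply: countable_setU => //; exact: countable_fset.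
apply: iM; apply: (sub_finite_set _ (finite_fset S)) => a Ma /=.
apply/negPn/negP => /fg; rewrite g1 fE asboolF; last by move=> /(_ Ma).
by move/eqP; rewrite eq_sym oner_eq0.
Qed.

(** * Measures of points, finite sets and lines *)

Lemma tame_dirac N A h b :
  tame N (fib A b) h -> (forall a s, a != b -> size s = N -> ~ A (a :: s)) ->
  tame N.+1 A h.
Proof.
move=> tb A0; exists (fun a => if a == b then h else 0), 0, [fset b]%fset.
split=> [a||].
- have [->//|ab] := eqVneq a b; apply: tame_empty => s sN; exact: A0.
- by move=> a; rewrite in_fset1 => /negPf ->.
- by rewrite mul0r add0r big_seq_fset1 eqxx subr0.
Qed.

Lemma tame_set1 N (s : seq K) : size s = N -> tame N [set s] 1.
Proof.
elim: N s => [|N IH] [|b s] //= => [_|[sN]]; first by rewrite asboolT.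
apply: (@tame_dirac _ _ _ b) => [|a t ab _ [/eqP]]; last by rewrite (negPf ab).
by apply: (tame_ext _ (IH s sN)) => t _; split=> [->|[]].
Qed.

Lemma tame_seq N (r : seq (seq K)) :
  uniq r -> (forall s, s \in r -> size s = N) ->
  tame N [set s | s \in r] (size r)%:R.
Proof.
elim: r => [_ _|s r IH /= /andP[sr ur] rN]; first by apply: tame_empty.
have ts : tame N [set s] 1 by apply: tame_set1; rewrite rN ?mem_head.
have {}IH : tame N [set s | s \in r] (size r)%:R.
  by apply: IH => // t tr; rewrite rN // in_cons tr orbT.
rewrite -add1n natrD; apply: tame_ext (tame_setU _ ts IH).
  by move=> t _; split=> /= [[->|tr]|/predU1P//];
    rewrite in_cons ?eqxx ?tr ?orbT //; tauto.
by move=> t _ /= [-> e]; rewrite e in sr.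
Qed.

(** If [v 0] vanishes, the line lies over a single first coordinate and induction applies; otherwise
    it meets each hyperplane of fixed first coordinate in one point, and the constant 1 integrates
    to ['X]. *)
Lemma tame_line N (a v : nat -> K) : (exists2 i, (i < N)%N & v i != 0) ->
  tame N [set s | exists t, forall i, (i < N)%N -> s`_i = a i + t * v i] 'X.
Proof.
elim: N a v => [|N IH] a v [i iN vi] //.
have [v0|v0] := eqVneq (v 0%N) 0.
  apply: (@tame_dirac _ _ _ (a 0%N)).
    apply: (tame_ext _ (IH (a \o succn) (v \o succn) _)); last first.
      by case: i iN vi => [|i iN vi]; [rewrite v0 eqxx|exists i].
    move=> s sN; split=> [[t st]|[t st]]; exists t.
      by case=> [|j]; [rewrite v0 mulr0 addr0|exact: st].
    by move=> j jN; apply: (st j.+1).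
  move=> b s bn sN [t /(_ 0%N erefl)] /=; rewrite v0 mulr0 addr0 => e.
  by rewrite e eqxx in bn.
exists (fun=> 1), 1, fset0; split=> //; last by rewrite big_nil addr0 mul1r.
move=> b; pose t := (b - a 0%N) / v 0%N.
pose r := mkseq (fun i => a i.+1 + t * v i.+1) N.
apply: tame_ext (@tame_set1 N r (size_mkseq _ _)) => s sN; split=> [->|[u su]].
  exists t => -[_|j jN] /=; first by rewrite divfK // addrC subrK.
  by rewrite nth_mkseq.
have -> : s = r; last by [].
apply: (@eq_from_nth _ 0) => [|j jN]; first by rewrite size_mkseq.
rewrite sN in jN; rewrite nth_mkseq //; have /= -> := su j.+1 jN;
  congr (_ + _ * _).
by apply: (canRL (mulfK v0)); have /= -> := su 0%N erefl; rewrite addrC addKr.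
Qed.

End Measure.

(** * Counting polynomials as polynomials in [infty - aleph0] *)

Definition gap_var (v : 'I_2) : {poly {poly int}} :=
  if v == ord0 then 'X%:P else 'X%:P - 'X.

(* The outer variable stands for [infty - aleph0], the inner one for [infty];
   nonnegativity of the coefficients in this form excludes cancellations. *)
Definition gap_poly : count_poly -> {poly {poly int}} :=
  mmap (fun c : int => c%:~R) gap_var.

HB.instance Definition _ := GRing.RMorphism.copy gap_poly
  (mmap (intmul 1) gap_var : {rmorphism count_poly -> {poly {poly int}}}).

Lemma gap_poly_infty : gap_poly infty = 'X%:P.
Proof. by rewrite /gap_poly mmapX mmap1U. Qed.

Lemma gap_poly_aleph0 : gap_poly aleph0 = 'X%:P - 'X.
Proof. by rewrite /gap_poly mmapX mmap1U. Qed.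

Definition infty_eval : {poly int} -> count_poly :=
  horner_eval infty \o map_poly (intmul 1).
HB.instance Definition _ := GRing.RMorphism.on infty_eval.

Definition gap_eval : {poly {poly int}} -> count_poly :=
  horner_eval (infty - aleph0) \o map_poly infty_eval.
HB.instance Definition _ := GRing.RMorphism.on gap_eval.

Lemma gap_evalC c : gap_eval c%:P = infty_eval c.
Proof. by rewrite /gap_eval /= map_polyC /horner_eval hornerC. Qed.

(** By multiplicativity it is enough to look at the variables, where
    [infty - (infty - aleph0) = aleph0]. *)
Lemma gap_polyK : cancel gap_poly gap_eval.
Proof.
have infX : infty_eval 'X = infty by rewrite /infty_eval /= map_polyX
  /horner_eval hornerX.
have gapX : gap_eval 'X = infty - aleph0.
  by rewrite /gap_eval /= map_polyX /horner_eval hornerX.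
move=> p; rewrite [RHS]mpolyE rmorph_sum /=; apply: eq_bigr => M _.
rewrite rmorphM rmorph_int rmorph_prod mpolyXE_id mulrzl -scaler_int;
  congr (_ *: _); first by rewrite intz.
apply: eq_bigr => v _; rewrite rmorphXn /=; congr (_ ^+ _).
rewrite /gap_var; case: eqVneq => [->|v0]; first by rewrite gap_evalC infX.
rewrite rmorphB /= gap_evalC infX gapX opprB addrC subrK.
by congr 'X_(_); apply/val_inj; case: v v0 => [[|[]]].
Qed.

Lemma aleph0_free_gapP p : aleph0_free p <-> exists c, gap_poly p = c%:P.
Proof.
split=> [p0|[c pc] M].
  have : (size (gap_poly p) <= 1)%N; last by move/size1_polyC => ->; eexists.
  rewrite /gap_poly /mmap big_seq; elim/big_ind: _ => [|q r q1 r1|M /p0 M0].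
  - by rewrite size_poly0.
  - by rewrite (leq_trans (size_polyD _ _)) // geq_max q1.
  rewrite /mmap1 big_ord_recl big_ord1 (_ : lift _ _ = ord_max) ?M0;
    last exact/val_inj.
  by rewrite expr0 mulr1 mulrzl /gap_var eqxx -polyC_exp -polyCMz
    size_polyC_leq1.
rewrite -(gap_polyK p) pc gap_evalC /infty_eval /= /horner_eval horner_poly.
rewrite mcoeff_msupp raddf_sum /=; apply: contra_neqP => M0; apply: big1 => i _.
rewrite mulrzl raddfMz /= mcoeffXn (_ : (_ == M) = false) ?mul0rz //.
by apply/eqP => MU; apply: M0; rewrite -MU mulmnE mnm1E.
Qed.

Lemma gap_poly_inj : injective gap_poly.
Proof. exact: can_inj gap_polyK. Qed.

(** * The measure of a set with a counting polynomial *)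

Section Counted.
Variable R : realType.
Local Notation C := R[i].
Let unc := @complex_uncountable R.

(** On sequences, fixing a first coordinate is a cons, without casts between dimensions. Missing
    entries default to 0 and surplus ones are dropped, so [seqs] is meaningful only in length
    [N]. *)
Definition row_of_seq N (s : seq C) : 'rV[C]_N := \row_(i < N) s`_i.
Definition seq_of_row N (v : 'rV[C]_N) : seq C := [seq v 0 i | i <- enum 'I_N].
Definition seqs N (V : set 'rV[C]_N) : set (seq C) :=
  [set s | V (row_of_seq N s)].

Lemma size_seq_of_row N (v : 'rV[C]_N) : size (seq_of_row v) = N.
Proof. by rewrite size_map size_enum_ord. Qed.

Lemma seq_of_rowK N (v : 'rV[C]_N) : row_of_seq N (seq_of_row v) = v.
Proof.
apply/rowP => i; rewrite mxE (nth_map i) ?size_enum_ord //.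
by rewrite nth_ord_enum.
Qed.

Lemma row_of_seqK N s : size s = N -> seq_of_row (row_of_seq N s) = s.
Proof.
move=> sN; apply: (@eq_from_nth _ 0) => [|i]; rewrite size_seq_of_row // => iN.
rewrite (nth_map (Ordinal iN)) ?size_enum_ord // mxE.
by rewrite (nth_ord_enum _ (Ordinal iN)).
Qed.

Lemma row_of_seq_cat i d s t : size s = i ->
  row_of_seq (i + d) (s ++ t) = row_mx (row_of_seq i s) (row_of_seq d t).
Proof.
move=> si; apply/rowP => j; rewrite !mxE nth_cat si.
by case: splitP => k ->; rewrite mxE ?addKn.
Qed.

Lemma seqs_eq N (V W : set 'rV[C]_N) :
  (forall s, size s = N -> seqs V s <-> seqs W s) -> V = W.
Proof.
move=> VW; apply/seteqP; split=> v;
by rewrite -{1}[v]seq_of_rowK -{2}[v]seq_of_rowK => /VW; apply;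
  exact: size_seq_of_row.
Qed.

Lemma seqs_disjoint N (V W : set 'rV[C]_N) : V `&` W = set0 ->
  forall s, size s = N -> ~ (seqs V s /\ seqs W s).
Proof. by move=> VW s _ VWs; have : (V `&` W) (row_of_seq N s) := VWs;
  rewrite VW. Qed.

(** The invariant of the induction on derivations. The middle clauses say that a measure exists
    exactly when aleph0 is absent, and equals the polynomial; the outer ones rule out cancellation,
    among polynomials and among sets. *)
Definition count_spec N (V : set 'rV[C]_N) (p : count_poly) :=
  [/\ forall j, nneg (gap_poly p)`_j,
      forall c, gap_poly p = c%:P -> tame N (seqs V) c,
      forall c, tame N (seqs V) c -> exists d, gap_poly p = d%:P
    & good N (seqs V)].

Lemma tame_count_spec N (V : set 'rV[C]_N) p c :
  gap_poly p = c%:P -> tame N (seqs V) c -> count_spec V p.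
Proof.
move=> pc tV; split=> [j|d|d _|].
- rewrite pc coefC; case: eqP => _; last exact: nneg0.
  by have [] := tame_pos unc tV.
- by rewrite pc => /polyC_inj <-.
- by exists c.
- exact: (tame_good unc tV).
Qed.

Lemma count_spec_finite N (V : set 'rV[C]_N) : finite_set V ->
  count_spec V (#|` fset_set V|%fset)%:R.
Proof.
move=> fV; apply: (@tame_count_spec _ _ _ (#|` fset_set V|%fset)%:R).
  by rewrite rmorph_nat polyC_natr.
have -> : #|` fset_set V|%fset = size [seq seq_of_row v | v <- fset_set V].
  by rewrite size_map.
apply: tame_ext (tame_seq _ _) => [s sN||].
- split=> [/mapP[v + ->]|Vs];
  first by rewrite in_fset_set // inE /seqs /= seq_of_rowK.
  apply/mapP; exists (row_of_seq N s); last by rewrite row_of_seqK.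
  by rewrite in_fset_set // inE.
- by rewrite map_inj_uniq ?fset_uniq //; apply: can_inj (@seq_of_rowK N).
- by move=> s /mapP[v _ ->]; exact: size_seq_of_row.
Qed.

Lemma count_spec_line N (a v : 'rV[C]_N) : v != 0 ->
  count_spec [set a + t *: v | t in [set: C]] infty.
Proof.
move=> v0; apply: tame_count_spec gap_poly_infty _.
have [k vk] : exists k, v 0 k != 0.
  apply: contrapT => /forallNP v0'; case/eqP: v0; apply/rowP => k.
  by rewrite mxE; apply: contrapT => /eqP; exact: v0'.
have nthE (w : 'rV[C]_N) (i : 'I_N) : (seq_of_row w)`_i = w 0 i.
  by rewrite -{2}[w]seq_of_rowK mxE.
apply: tame_ext
  (@tame_line _ N (nth 0 (seq_of_row a)) (nth 0 (seq_of_row v)) _).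
  move=> s sN; split=> [[t st]|[t _ st]].
    exists t => //; apply/rowP => i; rewrite !mxE.
    by rewrite st // !nthE.
  exists t => i iN; have := congr1 (fun w : 'rV_N => w 0 (Ordinal iN)) st.
  by rewrite !mxE -!nthE.
by exists k => //; rewrite nthE.
Qed.

Lemma count_spec_union N (V W : set 'rV[C]_N) p q : V `&` W = set0 ->
  count_spec V p -> count_spec W q -> count_spec (V `|` W) (p + q).
Proof.
move=> /seqs_disjoint VW [p0 tp pt gV] [q0 tq qt gW].
have pq0 j := nnegD_eq0 (p0 j) (q0 j).
have seqsU : seqs (V `|` W) = seqs V `|` seqs W by [].
split=> [j|c|c|].
- by rewrite rmorphD coefD; exact: (pq0 j).1.
- rewrite rmorphD /= => pqc.
  (* Nonnegative coefficients with sum 0 both vanish, so aleph0 cannot disappear from a sum. *)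
  have pqj j : (gap_poly p)`_j.+1 = 0 /\ (gap_poly q)`_j.+1 = 0.
    by apply: (pq0 j.+1).2; rewrite -coefD pqc coefC.
  have pc : gap_poly p = ((gap_poly p)`_0)%:P.
    by apply/polyP => -[|j]; rewrite coefC //= (pqj j).1.
  have qc : gap_poly q = ((gap_poly q)`_0)%:P.
    by apply/polyP => -[|j]; rewrite coefC //= (pqj j).2.
  move: pqc; rewrite pc qc -polyCD => /polyC_inj <-.
  exact: tame_setU VW (tp _ pc) (tq _ qc).
- rewrite seqsU => /(good_setU_tame unc VW gV gW).
  case=> m1 [m2 [/pt[d pd] /qt[e qe]]].
  by exists (d + e); rewrite rmorphD /= pd qe polyCD.
- exact: (good_setU unc).
Qed.

Lemma count_spec_summand N (V W : set 'rV[C]_N) p q : V `&` W = set0 ->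
  aleph0_free p -> aleph0_free q ->
  count_spec (V `|` W) p -> count_spec W q -> count_spec V (p - q).
Proof.
move=> /seqs_disjoint VW /aleph0_free_gapP[c pc] /aleph0_free_gapP[d qd].
move=> [_ tp _ _] [_ tq _ _]; apply: (@tame_count_spec _ _ _ (c - d)).
  by rewrite rmorphB /= pc qd polyCB.
exact: tame_setU_subr VW (tp _ pc) (tq _ qd).
Qed.

Lemma count_spec_fibration i d (V : set 'rV[C]_(i + d)) p q :
  (forall a, (lsubmx @` V) a -> count_spec [set b | V (row_mx a b)] p) ->
  count_spec (lsubmx @` V) q -> count_spec V (p * q).
Proof.
set W := lsubmx @` V => cp [q0 tq qt gW].
have fibE s : size s = i ->
    seqs [set b | V (row_mx (row_of_seq i s) b)] = [set t | seqs V (s ++ t)].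
  by move=> si; apply/seteqP; split=> t; rewrite /seqs /= row_of_seq_cat.
have VW s t : size s = i -> size t = d -> seqs V (s ++ t) -> seqs W s.
  rewrite /seqs /= => si _; rewrite row_of_seq_cat // => Vst.
  by eexists; [exact: Vst|rewrite row_mxKl].
(* Over an empty base nothing is known about [p], but [q] is 0. Otherwise a nonempty fiber over [s0]
   is available. *)
have [W0|/existsNP[s0 /not_implyP[s0i /contrapT Ws0]]] :=
    pselect (forall s, size s = i -> ~ seqs W s).
  have tW := tame_empty W0; have [c qc] := qt _ tW.
  have c0 := tame_unique unc (tq _ qc) tW.
  apply: (@tame_count_spec _ _ _ 0).
    by rewrite rmorphM /= qc c0 mulr0.
  apply: tame_empty => u ui Vu; apply: (W0 (take i u)).
    by rewrite size_takel // ui leq_addr.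
  apply: (VW _ (drop i u)); rewrite ?cat_take_drop //.
    by rewrite size_takel // ui leq_addr.
  by rewrite size_drop ui addKn.
have fib_ne : exists2 t, size t = d & seqs V (s0 ++ t).
  have [v Vv vs0] := Ws0; exists (seq_of_row (rsubmx v)).
    exact: size_seq_of_row.
  by rewrite /seqs /= row_of_seq_cat // seq_of_rowK -vs0 hsubmxK.
have p0 j : nneg (gap_poly p)`_j by have [] := cp _ Ws0.
have {}cp s : size s = i -> seqs W s ->
    [/\ forall c, gap_poly p = c%:P -> tame d [set t | seqs V (s ++ t)] c,
        forall c, tame d [set t | seqs V (s ++ t)] c ->
          exists e, gap_poly p = e%:P
      & good d [set t | seqs V (s ++ t)]].
  by move=> si /cp[_]; rewrite fibE.
have [ps0 sp0 _] := cp _ s0i Ws0.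
have pN0 c : gap_poly p = c%:P -> c != 0.
  move=> /ps0/(tame_pos unc)[_ c0]; apply/eqP => /c0 n.
  by have [t td] := fib_ne; exact: n.
split=> [j|c|c tV|].
- by rewrite rmorphM coefM; apply: (nneg_sum_eq0 _).1 => k _; exact: nnegM.
- rewrite rmorphM /= => pqc.
  (* Degrees in the outer variable add up for nonzero factors, so a constant product has constant
     factors. *)
  have pn : gap_poly p != 0 by apply/eqP => e; have /eqP := pN0 0 e.
  have qn : gap_poly q != 0.
    apply/eqP => /(tq 0)/(tame_pos unc)[_ /(_ erefl)]/(_ _ s0i); exact.
  have e := size_mul pn qn; rewrite pqc in e.
  have [/size1_polyC pc /size1_polyC qc] :
      (size (gap_poly p) <= 1)%N /\ (size (gap_poly q) <= 1)%N.
    move: (size_polyC_leq1 c) pn qn; rewrite e -!size_poly_gt0.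
    case: (size (gap_poly p)) (size (gap_poly q)) => [//|a] [//|b].
    by rewrite addSn addnS /= ltnS leqn0 addn_eq0 => /andP[/eqP-> /eqP->].
  move: pqc; rewrite pc qc -polyCM => /polyC_inj <-.
  apply: tame_fibration VW (tq _ qc) => s si Ws.
  by have [tp _ _] := cp _ si Ws; exact: tp.
(* The tame fiber over [s0] makes [p] free of aleph0; then the base is tame as well. *)
- have [k tk] := tame_fiber tV s0i; have [c' pc] := sp0 _ tk.
  have [e te] : exists e, tame i (seqs W) e.
    apply: tame_base (pN0 _ pc) _ VW tV => // s si Ws.
    by have [tp _ _] := cp _ si Ws; exact: tp.
  by have [f qf] := qt _ te; exists (c' * f); rewrite rmorphM /= pc qf polyCM.
- apply: (good_fibration unc (p0 0%N)) VW gW _.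
    by move=> s si Ws; have [] := cp _ si Ws.
  (* All fibers share the polynomial [p], so either all of them are tame or none is. *)
  have [[c pc]|np] := pselect (exists c, gap_poly p = c%:P); [left|right].
    rewrite pc coefC /=; split; first exact: pN0.
    by move=> s si Ws; have [+ _ _] := cp _ si Ws; exact.
  by move=> s k si Ws tk; apply: np; have [_ tp _] := cp _ si Ws; exact: tp tk.
Qed.

Lemma count_spec_cocountable (M : set 'rV[C]_1) :
  countable M -> infinite_set M ->
  count_spec (~` M) (infty - aleph0).
Proof.
move=> cM iM; have gX : gap_poly (infty - aleph0) = 'X.
  by rewrite rmorphB /= gap_poly_infty gap_poly_aleph0 opprB addrC subrK.
pose M' : set C := [set a | M (row_of_seq 1 [:: a])].
have rowE (v : 'rV[C]_1) : row_of_seq 1 [:: v 0 0] = v.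
  by apply/rowP => j; rewrite mxE ord1.
have cM' : countable M'.
  apply: sub_countable cM;
    apply: card_le_trans (card_image_le (fun v : 'rV_1 => v 0 0) M).
  by apply: subset_card_le => a Ma; eexists; [exact: Ma|rewrite mxE].
have iM' : infinite_set M'.
  move=> fM'; apply: iM;
    apply: sub_finite_set (finite_image (fun a => row_of_seq 1 [:: a]) fM').
  by move=> v Mv; exists (v 0 0); rewrite /M' /= rowE.
split=> [j|c|c|].
- by rewrite gX coefX; exact: nneg_nat.
- by rewrite gX => /(congr1 (size \o polyseq));
  rewrite /= size_polyX size_polyC; case: (c != 0).
- by move=> /(cocountable_not_tame unc cM' iM'); case.
- exact: (cocountable_good cM').
Qed.

Lemma countedP s N (V : set 'rV[C]_N) p : counted s V p -> count_spec V p.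
Proof.
elim=> {s N V p}.
- by move=> s N V; exact: count_spec_finite.
- by move=> s N a v; exact: count_spec_line.
- by move=> s N V W p q VW _ + _; exact: count_spec_union.
- by move=> s N V W p q VW _ cp _ cq p0 q0; exact: count_spec_summand cp cq.
- by move=> s i d V p q _ cp _; exact: count_spec_fibration.
- by move=> s M; exact: count_spec_cocountable.
Qed.

(** Freeness of [p] gives [V] a measure, which forces [q] to be free of aleph0 and equal to that
    measure. *)
Lemma counting_polynomial_unique N (V : set 'rV[C]_N) p q :
  counting_polynomial V p -> counting_polynomial V q -> aleph0_free p -> p = q.
Proof.
move=> [s /countedP[_ tp _ _]] [t /countedP[_ tq qt _]] /aleph0_free_gapP[c pc].
apply: gap_poly_inj; have tV := tp _ pc; have [d qd] := qt _ tV.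
by rewrite pc qd (tame_unique unc tV (tq _ qd)).
Qed.

(** The difference of the two sets has measure 0, hence is empty. *)
Lemma counting_polynomial_sub_eq N (V W : set 'rV[C]_N) p : V `<=` W ->
  counting_polynomial V p -> counting_polynomial W p -> aleph0_free p -> V = W.
Proof.
move=> VW [s /countedP[_ tV _ _]] [t /countedP[_ tW _ _]].
case/aleph0_free_gapP => c pc.
have tD : tame N (seqs W `\` seqs V) (c - c).
  apply: tame_setU_subr (tV _ pc) => [u _ [[]]//|].
  apply: tame_ext (tW _ pc) => u _; split=> [Wu|[[]//|/VW//]].
  by have [Vu|nVu] := pselect (seqs V u); [right|left; split].
have [_ /(_ (subrr _)) D0] := tame_pos unc tD.
apply: seqs_eq => u uN; split=> [|Wu]; first exact: VW.
by apply: contrapT => Vu; exact: (D0 u uN).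
Qed.

End Counted.

(** * Solution sets are determined by their truncations *)

Section Locality.
Variables (m n : nat) (A : zmodType) (B : comNzRingType).
Implicit Type p : jet_poly m n A.

(** Used for equality of numbers and for congruence of power series up to a given degree. *)
Lemma jet_eval_rel (r : B -> B -> Prop) (sigma : A -> B) (v w : jet m n -> B)
    p :
  (forall a, r a a) ->
  (forall a b a' b', r a b -> r a' b' -> r (a + a') (b + b')) ->
  (forall a b a' b', r a b -> r a' b' -> r (a * a') (b * b')) ->
  (forall k, k \in monalg.msupp p -> forall x, x \in finsupp k ->
    r (v x) (w x)) ->
  r (jet_eval sigma v p) (jet_eval sigma w p).
Proof.
move=> r0 rD rM rvw; rewrite /jet_eval !monalg.mmapE !big_seq.
elim/big_ind2: _ => [|? ? ? ?|k kp]; [exact: r0|exact: rD|].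
apply: (rM) => //; rewrite !big_seq.
elim/big_ind2: _ => [|? ? ? ?|x xk]; [exact: r0|exact: rM|].
by elim: (k x) => [|e IH]; rewrite ?expr0 // !exprS; apply: rM => //;
  exact: rvw xk.
Qed.

Lemma jet_order_bound p : exists b, forall k, k \in monalg.msupp p ->
  forall x, x \in finsupp k -> (mdeg x.2 <= b)%N.
Proof.
exists (\max_(k <- monalg.msupp p) \max_(x <- finsupp k) mdeg x.2) => k kp x xk.
apply: leq_trans (leq_bigmax_seq _ kp isT).
exact: (@leq_bigmax_seq _ _ xpredT (fun x : jet m n => mdeg x.2) _ xk).
Qed.

End Locality.

Section Truncation.
Variables (R : realType) (m n : nat) (F : meromorphic_field R n).
Variables (lt : rel (jet m n)) (zeta : 'rV[R[i]]_n).
Implicit Types (f g : 'I_m -> mps n R[i]) (S : ar_system m F).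

Lemma truncate_eq l f g : truncate lt l f = truncate lt l g ->
  forall x : jet m n, (mdeg x.2 <= l)%N -> f x.1 x.2 = g x.1 x.2.
Proof.
move=> fg x xl.
have xin : x \in jets_upto lt l.
  rewrite mem_sort; apply/mapP;
    exists (x.1, BMultinom (xl : mdeg x.2 < l.+1)%N).
    by rewrite mem_enum.
  exact: surjective_pairing.
have ix : (index x (jets_upto lt l) < size (jets_upto lt l))%N.
  by rewrite index_mem.
have := congr1 (fun w : 'rV_ _ => w 0 (Ordinal ix)) fg.
by rewrite !mxE !(tnth_nth x) /= nth_index.
Qed.

Lemma jet_eval_coef_local (p : jet_poly m n R[i]) : exists l, forall f g,
  (forall x : jet m n, (mdeg x.2 <= l)%N -> f x.1 x.2 = g x.1 x.2) ->
  jet_eval idfun (fun x => f x.1 x.2) p = jet_eval idfun (fun x => g x.1 x.2) p.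
Proof.
have [b pb] := jet_order_bound p; exists b => f g fg.
apply: (@jet_eval_rel _ _ _ _ eq)
  => [//|? ? ? ? -> -> //|? ? ? ? -> -> //|k kp x xk].
exact/fg/(pb _ kp).
Qed.

Lemma jet_eval_diff_local (p : jet_poly m n F) k : exists l, forall f g,
  (forall x : jet m n, (mdeg x.2 <= l)%N -> f x.1 x.2 = g x.1 x.2) ->
  jet_eval (taylor zeta) (fun x => mps_deriv x.2 (f x.1)) p k =
  jet_eval (taylor zeta) (fun x => mps_deriv x.2 (g x.1)) p k.
Proof.
(* Derivatives of order at most [b] shift degrees by at most [b], and products up to degree [mdeg k]
   involve no higher terms. *)
have [b pb] := jet_order_bound p; exists (mdeg k + b)%N => f g fg.
pose r (u v : mps n R[i]) := forall h, (mdeg h <= mdeg k)%N -> u h = v h.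
suff rfg : r (jet_eval (taylor zeta) (fun x => mps_deriv x.2 (f x.1)) p)
         (jet_eval (taylor zeta) (fun x => mps_deriv x.2 (g x.1)) p).
  exact: rfg k (leqnn _).
apply: jet_eval_rel
  => [//|u v u' v' uv uv' h hk|u v u' v' uv uv' h hk|h hp x xh j jk].
- by rewrite /GRing.add /= uv // uv'.
- change (mps_mul u u' h = mps_mul v v' h).
  rewrite (@mps_trunc_mul _ _ (mdeg k).+1 v v') ?ltnS //.
  apply: (@mps_mulE _ _ (mdeg k).+1) => [|l lk|l lk]; rewrite ?ltnS //.
    by rewrite mps_truncE // uv.
  by rewrite mps_truncE // uv'.
- rewrite /mps_deriv; congr (_ *+ _).
  by apply: (fg (x.1, j + x.2)%MM); rewrite mdegD leq_add // (pb _ hp).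
Qed.

(** Each single condition involves finitely many coefficients of [f], so it can be checked on a
    solution that agrees with [f] far enough; that solution may vary with the condition. *)
Lemma Sol_truncate S f :
  (forall l0,
    exists2 l, (l0 <= l)%N & Sol_upto lt zeta S l (truncate lt l f)) ->
  Sol zeta S f.
Proof.
move=> Sf; have agree l0 : exists2 g, Sol zeta S g &
    forall x : jet m n, (mdeg x.2 <= l0)%N -> f x.1 x.2 = g x.1 x.2.
  have [l l0l [g Sg gf]] := Sf l0; exists g => // x xl.
  by apply: (truncate_eq (esym gf)); exact: leq_trans l0l.
split=> p pS.
- apply/funext => k; have [l loc] := jet_eval_diff_local p k.
  by have [g [gd _ _] fg] := agree l; rewrite (loc _ _ fg) gd.
- have [l loc] := jet_eval_coef_local p.
  by have [g [_ ge _] fg] := agree l; rewrite (loc _ _ fg) ge.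
- have [l loc] := jet_eval_coef_local p.
  by have [g [_ _ gi] fg] := agree l; rewrite (loc _ _ fg) gi.
Qed.

Lemma Sol_eq_of_truncations S1 S2 (l0 : nat) : Sol zeta S1 `<=` Sol zeta S2 ->
  (forall l, (l0 <= l)%N -> Sol_upto lt zeta S1 l = Sol_upto lt zeta S2 l) ->
  Sol zeta S1 = Sol zeta S2.
Proof.
move=> S12 eS; apply/seteqP; split=> // f S2f; apply: Sol_truncate => l1.
by exists (maxn l0 l1); rewrite ?leq_maxr // eS ?leq_maxl //; exists f.
Qed.

End Truncation.

(** * Differential counting polynomials *)

Lemma count_rootE n p : count_root n p = \sum_(M <- msupp p)
  (p@_M)%:~R *:
    'X_[ [multinom if v == ord0 then (n`! * M v)%N else M v | v < 2] ].
Proof.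
apply: eq_bigr => M _; rewrite mulrzl scaler_int; congr (_ *~ _).
rewrite [RHS]mpolyXE_id; apply: eq_bigr => v _; rewrite mnmE;
  case: eqVneq => [->|v0]; first by rewrite exprM.
by congr ('X_ _ ^+ _); apply/val_inj; case: v v0 => [[|[]]].
Qed.

(** Multiplying an exponent by the positive number [n!] is injective, so no two monomials merge. *)
Lemma mcoeff_count_root n p (M : 'X_{1..2}) :
  (count_root n p)@_[multinom if v == ord0 then (n`! * M v)%N else M v | v < 2]
  = (p@_M)%:~R.
Proof.
rewrite count_rootE [in RHS](mpolyE p) !raddf_sum /=; apply: eq_bigr => M' _.
rewrite !mcoeffZ !mcoeffX rmorphM /= rmorph_nat; congr (_ * (nat_of_bool _)%:R).
apply/eqP/eqP => [/mnmP e|-> //]; apply/mnmP => v; have := e v; rewrite !mnmE.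
by case: ifP => // _ /eqP; rewrite eqn_pmul2l ?fact_gt0 // => /eqP.
Qed.

Lemma count_root_inj n : injective (count_root n).
Proof.
move=> p q pq; apply/mpolyP => M; apply: (@intr_inj rat).
by rewrite -!(mcoeff_count_root n) pq.
Qed.

Section DiffCount.
Variable n : nat.
Implicit Types (p q : diff_count_poly n) (M : 'X_{1..2 + n.+1}).

Definition deg_l M := M (lshift n.+1 (ord0 : 'I_2)).
(** The exponent at [l] of the [n!]-th root of infty. *)
Definition deg_infty l M :=
  (\sum_(i < n.+1) n`! %/ i`! * l ^ i * M (rshift 2 i))%N.
Definition eval_mnm l M : 'X_{1..2} :=
  [multinom if v == ord0 then deg_infty l M else M (diff_aleph0 n) | v < 2].

Lemma diff_count_evalE l p : diff_count_eval l p = \sum_(M <- msupp p)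
  (p@_M * l%:R ^+ deg_l M) *: 'X_[eval_mnm l M].
Proof.
apply: eq_bigr => M _; rewrite /mmap1 big_split_ord /=.
rewrite (@big_ord_recl _ _ _ 1%N) big_ord1 !(unsplitK (inl _)) /=.
under [X in _ * (_ * X)]eq_bigr do rewrite (unsplitK (inr _)) -exprM.
rewrite -expr_sum -[RHS]mul_mpolyC mpolyCM rmorphXn -!mulrA;
  congr (_ * (_ * _)).
rewrite [RHS]mpolyXE_id (@big_ord_recl _ _ _ 1%N) big_ord1 !mnmE /= mulrC.
by congr ('X_ _ ^+ _ * 'X_ _ ^+ M _); apply/val_inj.
Qed.

Lemma mem_eval_mnm l p N : N \in msupp (diff_count_eval l p) ->
  exists2 M, M \in msupp p & eval_mnm l M = N.
Proof.
rewrite mcoeff_msupp diff_count_evalE raddf_sum /= => s0; apply: contrapT => nM.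
case/eqP: s0; rewrite big_seq; apply: big1 => M Mp; rewrite mcoeffZ mcoeffX.
by case: eqP => [e|_]; [case: nM; exists M|rewrite mulr0].
Qed.

Lemma count_root_aleph0_free l p c :
  count_root n c = diff_count_eval l p -> diff_aleph0_free p -> aleph0_free c.
Proof.
move=> cp p0 M Mc.
pose N := [multinom if v == ord0 then (n`! * M v)%N else M v | v < 2].
have : N \in msupp (diff_count_eval l p).
  rewrite mcoeff_msupp -cp mcoeff_count_root intr_eq0.
  by rewrite -mcoeff_msupp.
case/mem_eval_mnm => M' /p0 M'0 /(congr1 (fun K : 'X_{1..2} => K ord_max)).
by rewrite !mnmE /= M'0.
Qed.

Lemma poly_eq0_of_large (P : {poly rat}) (l0 : nat) :
  (forall l, (l0 <= l)%N -> P.[l%:R] = 0) -> P = 0.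
Proof.
move=> P0; apply/eqP; apply: contraT => Pn.
have := @max_poly_roots _ P [seq i%:R | i <- iota l0 (size P)] Pn.
rewrite size_map size_iota ltnn; apply.
  by apply/allP => x /mapP[i + ->]; rewrite mem_iota => /andP[/P0 + _] => /eqP.
by rewrite map_inj_uniq ?iota_uniq // => i j /eqP; rewrite eqr_nat => /eqP.
Qed.

Definition deg_infty_poly M : {poly rat} :=
  \poly_(i < n.+1) (n`! %/ i`! * M (rshift 2 (inord i)))%:R.

Lemma horner_deg_infty_poly M l :
  (deg_infty_poly M).[l%:R] = (deg_infty l M)%:R.
Proof.
rewrite horner_poly natr_sum; apply: eq_bigr => i _.
by rewrite inord_val -natrX -natrM mulnAC.
Qed.

Lemma deg_infty_poly_inj M M' : deg_infty_poly M = deg_infty_poly M' ->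
  forall i, M (rshift 2 i) = M' (rshift 2 i).
Proof.
move=> e i; have /eqP := congr1 (fun P : {poly rat} => P`_i) e.
rewrite !coef_poly ltn_ord inord_val eqr_nat eqn_pmul2l => [/eqP //|].
by rewrite divn_gt0 ?fact_gt0 // leq_fact // -ltnS.
Qed.

(** Monomials whose exponents are different polynomials in [l] collide at only finitely many [l]. At
    the other large [l], the coefficient of one evaluated monomial is a polynomial in [l] that has
    to vanish. *)
Lemma diff_count_eval_eq0 p (l0 : nat) :
  (forall l, (l0 <= l)%N -> diff_count_eval l p = 0) -> p = 0.
Proof.
move=> p0; apply/eqP; rewrite -msupp_eq0; apply/negPn/negP => pn.
have [M Mp] : exists M, M \in msupp p.
  by case: (msupp p) pn => // M ? _; exists M; rewrite mem_head.
pose alike M' := (deg_infty_poly M' == deg_infty_poly M) &&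
  (M' (diff_aleph0 n) == M (diff_aleph0 n)).
pose P := \sum_(M' <- msupp p | alike M') p@_M' *: 'X^(deg_l M').
(* [Q] vanishes where another exponent polynomial accidentally meets that of [M]; elsewhere [P]
   evaluates to the coefficient at [eval_mnm l M]. *)
pose Q := \prod_(M' <- msupp p | deg_infty_poly M' != deg_infty_poly M)
  (deg_infty_poly M' - deg_infty_poly M).
have Qn : Q != 0 by rewrite prodf_seq_neq0; apply/allP => M' _;
  rewrite subr_eq0 implybb.
have : Q * P = 0.
  apply: (@poly_eq0_of_large _ l0) => l /p0 pl0; rewrite hornerM.
  have [->|Ql] := eqVneq Q.[l%:R] 0; first by rewrite mul0r.
  rewrite [P.[_]](_ : _ = 0) ?mulr0 //.
  have := congr1 (mcoeff (eval_mnm l M)) pl0.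
  rewrite diff_count_evalE mcoeff0 raddf_sum /= => <-.
  rewrite horner_sum big_mkcond; apply: eq_big_seq => M' M'p.
  rewrite mcoeffZ mcoeffX hornerZ hornerXn.
  suff -> : (eval_mnm l M' == eval_mnm l M) = alike M'.
    by case: ifP; rewrite ?mulr1 ?mulr0.
  apply/eqP/andP => [/mnmP e|[/eqP e1 /eqP e2]]; last first.
    apply/mnmP => v; rewrite !mnmE e2; case: eqP => // _.
    by apply/eqP; rewrite -(eqr_nat rat) -!horner_deg_infty_poly e1.
  have := e ord_max; have := e ord0; rewrite !mnmE /= => e1 ->; split=> //.
  apply: contraNT Ql => ne; rewrite horner_prod prodf_seq_eq0.
  apply/hasP; exists M' => //; rewrite ne hornerD hornerN.
  by rewrite !horner_deg_infty_poly e1 subrr eqxx.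
move/eqP; rewrite mulf_eq0 (negPf Qn) /= => /eqP.
move/(congr1 (fun P : {poly rat} => P`_(deg_l M))).
(* Among the monomials alike to [M] only [M] itself has the same exponent of [l], so this
   coefficient of [P] is that of [M] in [p]. *)
rewrite /P coef_sum coef0 -big_filter (bigD1_seq M) ?filter_uniq ?msupp_uniq //=;
  last by rewrite mem_filter /alike !eqxx.
rewrite coefZ coefXn eqxx mulr1 big1_seq ?addr0 => [/eqP|M' /andP[ne]].
  by rewrite mcoeff_eq0 Mp.
rewrite mem_filter => /andP[/andP[/eqP e1 /eqP e2] _].
rewrite coefZ coefXn; case: eqP => [e0|_]; last by rewrite mulr0.
case/eqP: ne; apply/mnmP => v; case: (split_ordP v) => i ->;
  last exact: deg_infty_poly_inj.
have [->|i0] := eqVneq i ord0; first exact: esym.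
by rewrite (_ : i = ord_max) //; apply/val_inj; case: i i0 => [[|[]]].
Qed.

Lemma diff_count_eval_inj p q (l0 : nat) :
  (forall l, (l0 <= l)%N -> diff_count_eval l p = diff_count_eval l q) -> p = q.
Proof.
move=> pq; apply/eqP; rewrite -subr_eq0; apply/eqP.
apply: (@diff_count_eval_eq0 _ l0) => l /pq e.
by rewrite /diff_count_eval raddfB /= -/(diff_count_eval l p) e subrr.
Qed.

End DiffCount.

(** * Comparison of the two systems *)

Theorem theorem4p3 (R : realType) (m n : nat) (F : meromorphic_field R n)
  (lt : rel (jet m n)) (lt_orderly : orderly_ranking lt)
  (zeta : 'rV[R[i]]_n) (S1 S2 : ar_system m F)
  (hol1 : coefs_holomorphic_at zeta S1) (hol2 : coefs_holomorphic_at zeta S2)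
  (sub12 : Sol zeta S1 `<=` Sol zeta S2) :
  (forall c1 c2 : nat -> count_poly,
     counting_sequence lt zeta S1 c1 -> counting_sequence lt zeta S2 c2 ->
     (forall l, aleph0_free (c1 l)) -> (forall l, aleph0_free (c2 l)) ->
     (Sol zeta S1 = Sol zeta S2 <-> forall l, c1 l = c2 l) /\
     (forall c, counting_sequence lt zeta S1 c -> forall l, c l = c1 l)) /\
  (forall p1 p2 : diff_count_poly n,
     diff_counting_polynomial lt zeta S1 p1 ->
     diff_counting_polynomial lt zeta S2 p2 ->
     diff_aleph0_free p1 -> diff_aleph0_free p2 ->
     (Sol zeta S1 = Sol zeta S2 <-> p1 = p2) /\
     (forall p, diff_counting_polynomial lt zeta S1 p -> p = p1)).
Proof.
have Sol_upto_sub l : Sol_upto lt zeta S1 l `<=` Sol_upto lt zeta S2 l.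
  exact: image_subset.
have Sol_uptoE : Sol zeta S1 = Sol zeta S2 ->
    forall l, Sol_upto lt zeta S1 l = Sol_upto lt zeta S2 l.
  by move=> e l; rewrite /Sol_upto e.
split=> [c1 c2 cS1 cS2 c10 c20|p1 p2 [c1 cS1 [l1 cp1]] [c2 cS2 [l2 cp2]]
  p10 p20].
  split=> [|c cS l];
    last by rewrite (counting_polynomial_unique (cS1 l) (cS l)).
  split=> [/Sol_uptoE e l|c12].
    apply: counting_polynomial_unique (cS1 l) _ (c10 l); rewrite e; exact: cS2.
  apply: (@Sol_eq_of_truncations _ _ _ _ lt _ _ _ 0%N) => // l _.
  apply: counting_polynomial_sub_eq (cS1 l) _ (c10 l) => //.
  by rewrite c12; exact: cS2.
(* Here aleph0 is known to be absent only from [l1] on, which suffices because long truncations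
   already determine the solutions. *)
have c10 l : (l1 <= l)%N -> aleph0_free (c1 l).
  by move=> /cp1 e; exact: count_root_aleph0_free e p10.
split=> [|p [c cS [l0 cp]]]; last first.
  apply: (@diff_count_eval_inj _ _ _ (maxn l0 l1)) => l.
  rewrite geq_max => /andP[ll0 ll1]; rewrite -cp // -cp1 //.
  by rewrite (counting_polynomial_unique (cS1 l) (cS l) (c10 l ll1)).
split=> [/Sol_uptoE e|p12].
  apply: (@diff_count_eval_inj _ _ _ (maxn l1 l2)) => l.
  rewrite geq_max => /andP[ll1 ll2]; rewrite -cp1 // -cp2 //; congr count_root.
  apply: counting_polynomial_unique (cS1 l) _ (c10 l ll1); rewrite e;
    exact: cS2.
apply: (@Sol_eq_of_truncations _ _ _ _ lt _ _ _ (maxn l1 l2)) => // l.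
rewrite geq_max => /andP[ll1 ll2].
apply: counting_polynomial_sub_eq (cS1 l) _ (c10 l ll1) => //.
suff -> : c1 l = c2 l by exact: cS2.
by apply: (@count_root_inj n); rewrite cp1 // cp2 // p12.
Qed.
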